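(* If at least one of the following two conditions holds, then $\mathcal V=\mathcal V^m$: (SC1) there exists a function $U:\mathbb R^n\setminus\overset{\circ}{\mathcal T}\to\mathbb R_+$ of class $C^1$ in $\mathbb R^n\setminus\overset{\circ}{\mathcal T}$, positive definite and proper on $\mathcal T^c$, such that for all $x\in\mathcal T^c$ $$\sup_{a\in A}\langle\nabla U(x),f(x,a)\rangle\le-m(\mathbf d(x))$$ for some continuous, increasing function $m:\,]0,+\infty[\,\to\,]0,+\infty[$; (SC2) there exists a continuous, increasing function $c_2:\,]0,+\infty[\,\to\,]0,+\infty[$ such that $l(x,a)\ge c_2(\mathbf d(x))$ for all $(x,a)\in\mathcal T^c\times A$.
   Context: Standing setting. $A\subset\mathbb R^m$ is compact; the target $\mathcal T\subset\mathbb R^n$ is closed with compact boundary; $\mathcal T^c=\mathbb R^n\setminus\mathcal T$, $\overset{\circ}{\mathcal T}$ is the interior of $\mathcal T$, $\mathbf d(x)=\mathrm{dist}(x,\mathcal T)$, $\mathbb R_+=[0,+\infty[$. The functions $f:\mathbb R^n\times A\to\mathbb R^n$ and $l:\mathbb R^n\times A\to\mathbb R_+$ are continuous; there is $M>0$ with $|f(x,a)|\le M(1+|x|)$ for all $(x,a)$, and for every $R>0$ there is $L_R>0$ with $|f(x_1,a)-f(x_2,a)|\le L_R|x_1-x_2|$ and $|l(x_1,a)-l(x_2,a)|\le L_R|x_1-x_2|$ whenever $|x_1|,|x_2|\le R$, $a\in A$. $\mathcal A$ is the set of measurable controls $\alpha:\mathbb R_+\to A$, and $y_x(\cdot,\alpha)$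 is the solution on $\mathbb R_+$ of $\dot y(t)=f(y(t),\alpha(t))$, $y(0)=x$. Put $t_x(\alpha)=\inf\{t\ge0: y_x(t,\alpha)\in\mathcal T\}\le+\infty$, $\mathcal J(t,x,\alpha)=\int_0^t l(y_x(s,\alpha),\alpha(s))\,ds$, and $\mathcal A(x)=\{\alpha\in\mathcal A:\ \liminf_{t\to t_x(\alpha)^-}\mathbf d(y_x(t,\alpha))=0\}$. For $x\in\mathcal T^c$: $\mathcal V(x)=\inf_{\alpha\in\mathcal A(x)}\mathcal J(t_x(\alpha),x,\alpha)$ and $\mathcal V^m(x)=\inf_{\alpha\in\mathcal A}\mathcal J(t_x(\alpha),x,\alpha)$ (with $\inf\emptyset=+\infty$). $U$ is positive definite on $\mathcal T^c$ if $U>0$ on $\mathcal T^c$ and $U=0$ on $\partial\mathcal T$; $U$ is proper if $U^{-1}(K)$ is compact for every compact $K\subset\mathbb R_+$. *)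

(* Defs.v *)
From HB Require Import structures.
From mathcomp Require Export all_boot all_order all_algebra.
From mathcomp Require Export all_classical all_reals all_analysis.
Export Order.TTheory GRing.Theory Num.Theory.
Export numFieldNormedType.Exports.

Set Implicit Arguments.
Unset Strict Implicit.
Unset Printing Implicit Defensive.

Local Open Scope classical_set_scope.
Local Open Scope ring_scope.

(* The norm that MathComp-Analysis puts on 'rV[R]_n is the sup norm. It is used
   here only for the topology and for derivatives; |x| and dist(x, T) are
   Euclidean. *)
Definition dot (R : realType) (n : nat) (u v : 'rV[R]_n) : R :=
  \sum_(i < n) u 0 i * v 0 i.

Definition enorm (R : realType) (n : nat) (u : 'rV[R]_n) : R :=
  Num.sqrt (dot u u).

Definition edistance (R : realType) (n : nat) (T : set 'rV[R]_n)
    (x : 'rV[R]_n) : R :=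
  inf [set enorm (x - z) | z in T].

Definition grad (R : realType) (n : nat) (U : 'rV[R]_n -> R) (x : 'rV[R]_n) :
    'rV[R]_n :=
  \row_(i < n) 'D_(delta_mx 0 i) U x.

(* S need not be open: differentiability at a point of S is relative to S, with
   derivative G continuous on S. At interior points of S, G is the gradient. *)
Definition C1_on (R : realType) (n : nat) (S : set 'rV[R]_n)
    (U : 'rV[R]_n -> R) : Prop :=
  exists2 G : 'rV[R]_n -> 'rV[R]_n,
    {within S, continuous G} &
    forall x, S x -> forall e : R, 0 < e ->
      \forall z \near within S (nbhs x),
        `|U z - U x - dot (G x) (z - x)| <= e * enorm (z - x).

(* Functions whose natural domain is a subset of R^n (such as R_+, ]0, +oo[, A,
   or the complement of the interior of T) are total functions below, and
   only their values on that domain matter. *)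

Definition control (R : realType) (m : nat) (A : set 'rV[R]_m)
    (alpha : R -> 'rV[R]_m) : Prop :=
  (forall t : R, 0 <= t -> A (alpha t)) /\
  (* Caratheodory sets of the outer measure generated by interval length, i.e.
     Lebesgue (not merely Borel) measurable sets *)
  forall O : set 'rV[R]_m, open O ->
    ((wlength (@idfun R))^*)%mu.-cara.-measurable
      [set t : R | 0 <= t /\ O (alpha t)].

Definition absolutely_continuous (R : realType) (n : nat) (a b : R)
    (y : R -> 'rV[R]_n) : Prop :=
  forall e : R, 0 < e -> exists2 d : R, 0 < d &
    forall (k : nat) (u v : 'I_k -> R),
      (forall i, [/\ a <= u i, u i <= v i & v i <= b]) ->
      (forall i j, i != j -> v i <= u j \/ v j <= u i) ->
      \sum_(i < k) (v i - u i) < d ->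
      \sum_(i < k) enorm (y (v i) - y (u i)) < e.

(* Caratheodory solution on R_+ of y' = f(y, alpha), y(0) = x *)
Definition solution (R : realType) (n m : nat)
    (f : 'rV[R]_n -> 'rV[R]_m -> 'rV[R]_n) (x : 'rV[R]_n)
    (alpha : R -> 'rV[R]_m) (y : R -> 'rV[R]_n) : Prop :=
  [/\ y 0 = x,
      forall b : R, 0 <= b -> absolutely_continuous 0 b y &
      {ae (@lebesgue_measure R), forall t : R, 0 < t ->
        is_derive t (1 : R) y (f (y t) (alpha t))}].

Definition hitting_time (R : realType) (n : nat) (T : set 'rV[R]_n)
    (y : R -> 'rV[R]_n) : \bar R :=
  ereal_inf [set t%:E | t in [set t : R | 0 <= t /\ T (y t)]].

Definition cost (R : realType) (n m : nat) (l : 'rV[R]_n -> 'rV[R]_m -> R)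
    (y : R -> 'rV[R]_n) (alpha : R -> 'rV[R]_m) (tau : \bar R) : \bar R :=
  (\int[@completed_lebesgue_measure R]_(s in
      [set s : R | (0 <= s)%R /\ s%:E < tau]) (l (y s) (alpha s))%:E)%E.

(* the filter t -> tau^- on R, for tau in ]-oo, +oo]; the value at -oo is junk *)
Definition ereal_at_left (R : realType) (tau : \bar R) : set_system R :=
  match tau with
  | r%:E => at_left r
  | +oo => pinfty_nbhs R
  | -oo => ninfty_nbhs R
  end%E.

Definition admissible (R : realType) (n m : nat) (T : set 'rV[R]_n)
    (A : set 'rV[R]_m) (y : 'rV[R]_n -> (R -> 'rV[R]_m) -> R -> 'rV[R]_n)
    (x : 'rV[R]_n) (alpha : R -> 'rV[R]_m) : Prop :=
  control A alpha /\
  limf_einf (fun t : R => (edistance T (y x alpha t))%:E)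
    (ereal_at_left (hitting_time T (y x alpha))) = 0%E.

Definition value (R : realType) (n m : nat) (T : set 'rV[R]_n)
    (A : set 'rV[R]_m) (l : 'rV[R]_n -> 'rV[R]_m -> R)
    (y : 'rV[R]_n -> (R -> 'rV[R]_m) -> R -> 'rV[R]_n) (x : 'rV[R]_n) : \bar R :=
  ereal_inf [set cost l (y x alpha) alpha (hitting_time T (y x alpha))
            | alpha in admissible T A y x].

Definition value_m (R : realType) (n m : nat) (T : set 'rV[R]_n)
    (A : set 'rV[R]_m) (l : 'rV[R]_n -> 'rV[R]_m -> R)
    (y : 'rV[R]_n -> (R -> 'rV[R]_m) -> R -> 'rV[R]_n) (x : 'rV[R]_n) : \bar R :=
  ereal_inf [set cost l (y x alpha) alpha (hitting_time T (y x alpha))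
            | alpha in control A].

(* continuous, increasing (in the wide sense) ]0, +oo[ -> ]0, +oo[ *)
Definition positive_increasing (R : realType) (c : R -> R) : Prop :=
  [/\ {within [set r : R | 0 < r], continuous c},
      forall r s : R, 0 < r -> r <= s -> c r <= c s &
      forall r : R, 0 < r -> 0 < c r].

Definition positive_definite (R : realType) (n : nat) (T : set 'rV[R]_n)
    (U : 'rV[R]_n -> R) : Prop :=
  (forall x, ~ T x -> 0 < U x) /\
  (forall x, (closure T `\` interior T) x -> U x = 0).

Definition proper_fun (R : realType) (n : nat) (T : set 'rV[R]_n)
    (U : 'rV[R]_n -> R) : Prop :=
  forall K : set R, compact K -> K `<=` [set r | 0 <= r] ->
    compact (~` interior T `&` U @^-1` K).

Definition SC1 (R : realType) (n m : nat) (T : set 'rV[R]_n)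
    (A : set 'rV[R]_m) (f : 'rV[R]_n -> 'rV[R]_m -> 'rV[R]_n) : Prop :=
  exists U : 'rV[R]_n -> R,
    [/\ forall x : 'rV[R]_n, (~` interior T) x -> 0 <= U x,
        C1_on (~` interior T) U,
        positive_definite T U,
        proper_fun T U &
        exists2 mu : R -> R, positive_increasing mu &
          forall x, ~ T x ->
            (ereal_sup [set (dot (grad U x) (f x a))%:E | a in A]
              <= (- mu (edistance T x))%:E)%E].

Definition SC2 (R : realType) (n m : nat) (T : set 'rV[R]_n)
    (A : set 'rV[R]_m) (l : 'rV[R]_n -> 'rV[R]_m -> R) : Prop :=
  exists2 c2 : R -> R, positive_increasing c2 &
    forall x a, ~ T x -> A a -> c2 (edistance T x) <= l x a.

(* Main.v *)
Require Import Defs.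
From mathcomp Require Import ring lra.

Set Implicit Arguments.
Unset Strict Implicit.
Unset Printing Implicit Defensive.

Local Open Scope classical_set_scope.
Local Open Scope ring_scope.

(* A trajectory that reaches T in finite time is admissible, by continuity. So a
   control that is not admissible never reaches T, and from some time on its
   trajectory stays at distance at least r > 0 from T. Under (SC2) the running
   cost is then eventually at least c2(r) > 0 and the total cost is infinite.
   Under (SC1) U decreases along the trajectory at rate at least m(r) > 0, which
   contradicts U >= 0. The decrease of U along the merely absolutely continuous
   trajectory comes from a Cousin-type covering argument: a tag outside the null
   set of bad times gives small intervals with the right slope, and a tag in it
   gives small intervals inside an open set of small measure, whose increments
   are small in total by absolute continuity. *)

(** * Euclidean norm and inner product against the sup norm *)

Lemma normr_le_enorm (R : realType) (n : nat) (u : 'rV[R]_n) : `|u| <= enorm u.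
Proof.
have dot_ge0 : 0 <= dot u u by apply: sumr_ge0 => i _; rewrite -expr2 sqr_ge0.
rewrite [leLHS]mx_normrE; apply/bigmax_leP; split => [|[i j] _ /=].
  exact: sqrtr_ge0.
rewrite (ord1 i) -sqrtr_sqr ler_sqrt // /dot (bigD1 j) //= expr2 lerDl.
by apply: sumr_ge0 => k _; rewrite -expr2 sqr_ge0.
Qed.

Lemma normr_coord_le (R : realType) (n : nat) (u : 'rV[R]_n) (i : 'I_n) :
  `|u 0 i| <= `|u|.
Proof.
rewrite [leRHS]mx_normrE.
exact: (le_bigmax _ (fun ij : 'I_1 * 'I_n => `|u ij.1 ij.2|) (0, i)).
Qed.

Lemma normr_dot_le (R : realType) (n : nat) (u v : 'rV[R]_n) :
  `|dot u v| <= n%:R * (`|u| * `|v|).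
Proof.
apply: le_trans (ler_norm_sum _ _ _) _.
apply: (@le_trans _ _ (\sum_(i < n) `|u| * `|v|)).
  by apply: ler_sum => i _; rewrite normrM ler_pM // normr_coord_le.
by rewrite sumr_const card_ord mulr_natl.
Qed.

Lemma enorm_le_normr (R : realType) (n : nat) (u : 'rV[R]_n) :
  enorm u <= n.+1%:R * `|u|.
Proof.
have nu0 : 0 <= n.+1%:R * `|u| by rewrite mulr_ge0.
rewrite -(ger0_norm nu0) -sqrtr_sqr ler_sqrt ?sqr_ge0 //.
apply: le_trans (ler_norm _) (le_trans (normr_dot_le _ _) _).
rewrite exprMn -expr2 ler_wpM2r ?sqr_ge0 // -natrX ler_nat.
by rewrite (leq_trans (leqnSn n)) // leq_pmulr.
Qed.

Lemma enormB (R : realType) (n : nat) (u v : 'rV[R]_n) :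
  enorm (u - v) = enorm (v - u).
Proof.
congr Num.sqrt; apply: eq_bigr => i _.
by rewrite -[u - v]opprB mxE mulrNN.
Qed.

Lemma dotBr (R : realType) (n : nat) (u v w : 'rV[R]_n) :
  dot u (v - w) = dot u v - dot u w.
Proof. by rewrite -sumrB; apply: eq_bigr => i _; rewrite !mxE mulrBr. Qed.

Lemma dotZr (R : realType) (n : nat) (k : R) (u v : 'rV[R]_n) :
  dot u (k *: v) = k * dot u v.
Proof. by rewrite mulr_sumr; apply: eq_bigr => i _; rewrite mxE mulrCA. Qed.

(** * Increments along absolutely continuous paths *)

(** Cousin's lemma as an induction on intervals. With [c] the supremum of the [t] such that [P a t],
    the local hypothesis at [c] first joins a nearby such [t] to [c], then leads past [c] unless
    [c = b]. *)
Lemma interval_ind (R : realType) (P : R -> R -> Prop) (a b : R) :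
  a <= b ->
  (forall r s t, a <= r -> r <= s -> s <= t -> t <= b ->
    P r s -> P s t -> P r t) ->
  (forall t, a <= t <= b -> \forall s \near t, a <= s <= b ->
    (s <= t -> P s t) /\ (t <= s -> P t s)) ->
  P a b.
Proof.
move=> ab Ptrans Ploc.
pose S := [set t | a <= t <= b /\ P a t].
have Sa : S a.
  split; first by rewrite lexx.
  have aab : a <= a <= b by rewrite lexx.
  by have [+ _] := nbhs_singleton (Ploc _ aab) aab; apply.
have Sb : ubound S b by move=> t [/andP[]].
have supS : has_sup S by split; [exists a | exists b].
set c := sup S.
have le_c t : S t -> t <= c by move=> St; exact: (ub_le_sup supS.2).
have acb : a <= c <= b.
  by apply/andP; split; [exact: le_c|exact: ge_sup supS.1 Sb].
have /nbhs_ballP[e /= e0 He] := Ploc _ acb.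
have [t [tab Pat] ct] := sup_adherent e0 supS.
have tc : t <= c by exact: le_c.
have Pac : P a c.
  apply: (Ptrans a t c) => //; [by case/andP: tab|by case/andP: acb|].
  have [||+ _] := He t _ _ => //; last exact.
  by rewrite /ball /= ger0_norm ?subr_ge0 // ltrBlDr -ltrBlDl.
have [cb|bc] := ltP c b; last first.
  by have -> : b = c by apply/eqP; rewrite eq_le bc; case/andP: acb.
pose v := Num.min b (c + e / 2).
have cv : c < v by rewrite lt_min cb ltrDl divr_gt0.
have vb : v <= b by rewrite ge_min lexx.
have vab : a <= v <= b.
  by rewrite vb andbT (le_trans _ (ltW cv)) //; case/andP: acb.
have Pcv : P c v.
  have [||_] := He v _ _ => //; last by apply; exact: ltW.
  rewrite /ball /= distrC ger0_norm ?subr_ge0 ?(ltW cv) //.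
  have : v <= c + e / 2 by rewrite ge_min lexx orbT.
  by move=> ?; lra.
have : S v.
  by split => //; apply: (Ptrans a c v) => //; [by case/andP: acb|exact: ltW].
by move=> /le_c; rewrite leNgt cv.
Qed.

(** Both sides of [t] are treated because in [interval_ind] a tag may be the right or the left end
    of a small interval. *)
Lemma derivable_near_increment (R : realType) (g : R -> R) (t q : R) :
  derivable g t 1 -> 'D_1 g t <= q -> forall e, 0 < e -> \forall s \near t,
    (s <= t -> g t - g s <= (q + e) * (t - s)) /\
    (t <= s -> g s - g t <= (q + e) * (s - t)).
Proof.
move=> dg gq e e0.
have /cvgrPdist_lt /(_ e e0) : h^-1 *: (g (h *: 1 + t) - g t) @[h --> 0^'] -->
  'D_1 g t by exact: dg.
move=> /nbhs_ballP[r /= r0 Hr].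
apply/nbhs_ballP; exists r => //= s ts.
have [->|st] := eqVneq s t; first by split=> _; rewrite !subrr mulr0.
have st0 : s - t != 0 by rewrite subr_eq0.
have := Hr (s - t); rewrite /ball /= sub0r normrN distrC => /(_ ts st0).
rewrite [_ *: 1]mulr1 subrK ltr_norml => /andP[+ _].
set D := 'D_1 g t in gq *.
rewrite ltrBrDl -ltrBrDr opprK => HD.
have {}HD : (s - t)^-1 * (g s - g t) < q + e by apply: lt_le_trans HD _; lra.
split=> st'.
  have ts0 : 0 < t - s by rewrite subr_gt0 lt_neqAle st.
  rewrite -ler_pdivrMr //; apply: ltW; apply: le_lt_trans HD.
  by rewrite -(opprB s) -(opprB (g s)) invrN mulrNN mulrC.
have ts0 : 0 < s - t by rewrite subr_gt0 lt_neqAle eq_sym st.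
by rewrite -ler_pdivrMr //; apply: ltW; apply: le_lt_trans HD; rewrite mulrC.
Qed.

(** Half-open intervals make adjacent pieces disjoint, so the measures add exactly when two covers
    are concatenated. *)
Lemma open_itvco_measure_add (R : realType) (O : set R) (r s t : R) :
  open O -> r <= s -> s <= t ->
  lebesgue_measure (O `&` `[r, t[) =
  (lebesgue_measure (O `&` `[r, s[) + lebesgue_measure (O `&` `[s, t[))%E.
Proof.
move=> oO rs st.
have mO : measurable O by exact: measurable_realfun.open_measurable.
rewrite -measureU.
- rewrite -setIUr; congr (lebesgue_measure (O `&` _)).
  by rewrite -itv_bndbnd_setU // bnd_simp.
- by apply: measurableI.
- by apply: measurableI.
apply/seteqP; split => // x [[_ /=] ] + [_ /=].
by rewrite !in_itv /= => /andP[_ xs] /andP[sx _]; move: xs; rewrite ltNge sx.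
Qed.

(* Intervals [I] inside [O] absorb the increments of [g] that are not controlled
   by the slope [q]; their length is measured by [O], hence small. *)
Definition increment_cover (R : realType) (O : set R) (g : R -> R)
    (w : R -> R -> R) (q s t : R) : Prop :=
  exists I : seq (R * R),
    [/\ all (fun p => [&& s <= p.1, p.1 <= p.2 & p.2 <= t]) I,
        pairwise (fun p p' => p.2 <= p'.1) I,
        ((\sum_(p <- I) (p.2 - p.1))%:E <= lebesgue_measure (O `&` `[s, t[))%E &
        g t - g s <= q * (t - s) + \sum_(p <- I) w p.1 p.2].

Lemma increment_cover_trans (R : realType) (O : set R) (g : R -> R)
    (w : R -> R -> R) (q r s t : R) :
  open O -> r <= s -> s <= t ->
  increment_cover O g w q r s -> increment_cover O g w q s t ->
  increment_cover O g w q r t.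
Proof.
move=> oO rs st [I [Iin Idis ImO Ig]] [J [Jin Jdis JmO Jg]].
exists (I ++ J); split.
- rewrite all_cat; apply/andP; split.
    apply: sub_all Iin => p /and3P[-> -> ps] /=; exact: le_trans st.
  by apply: sub_all Jin => p /and3P[sp -> ->]; rewrite (le_trans rs).
- rewrite pairwise_cat Idis Jdis !andbT; apply/allrelP => p p' Ip Jp'.
  have /and3P[_ _ ps] := allP Iin _ Ip; have /and3P[sp _ _] := allP Jin _ Jp'.
  exact: le_trans sp.
- by rewrite big_cat /= EFinD (open_itvco_measure_add oO rs st) leeD.
- by rewrite big_cat /=; lra.
Qed.

(** Serves the tags in the null set, where the whole interval is absorbed; [increment_cover_nil]
    serves the other tags. *)
Lemma increment_cover_segment (R : realType) (O : set R) (g : R -> R)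
    (w : R -> R -> R) (q s t : R) :
  s <= t -> `[s, t[ `<=` O -> g t - g s <= q * (t - s) + w s t ->
  increment_cover O g w q s t.
Proof.
move=> st stO gst; exists [:: (s, t)]; split => //=.
- by rewrite !lexx st.
- rewrite big_seq1 (setIidr stO) lebesgue_measure_itv /= lte_fin.
  by case: ltP => //; rewrite lee_fin subr_le0.
- by rewrite big_seq1.
Qed.

Lemma increment_cover_nil (R : realType) (O : set R) (g : R -> R)
    (w : R -> R -> R) (q s t : R) :
  g t - g s <= q * (t - s) -> increment_cover O g w q s t.
Proof.
by move=> gst; exists [::]; split; rewrite ?big_nil ?addr0 // measure_ge0.
Qed.

(** Near a bad tag, the local bound by increments of [y] transfers the absolute continuity of [y] to
    [g]; near any other tag the slope [q + e] is enough. *)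
Lemma absolutely_continuous_increment_le (R : realType) (n : nat) (g : R -> R)
    (y : R -> 'rV[R]_n) (a b K q : R) :
  a <= b -> 0 <= K -> absolutely_continuous a b y ->
  (forall t, a <= t <= b ->
    \forall s \near t, `|g s - g t| <= K * enorm (y s - y t)) ->
  {ae (@lebesgue_measure R), forall t, a <= t <= b ->
    derivable g t 1 /\ 'D_1 g t <= q} ->
  g b - g a <= q * (b - a).
Proof.
move=> ab K0 acy gy [N [mN N0 sN]].
(* The errors are [e * (b - a)] from the slope, [K * e] from the increments of [y], and [e] from the
   total length of the bad intervals. *)
suff H e : 0 < e -> g b - g a <= q * (b - a) + e * (b - a + K + 1).
  apply/ler_addgt0Pr => e e0.
  have d0 : 0 < b - a + K + 1 by lra.
  apply: le_trans (H (e / (b - a + K + 1)) _) _; first exact: divr_gt0.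
  by rewrite mulfVK // gt_eqF.
move=> e0; have [d d0 Hd] := acy e e0.
have q1 : 0 < `|q| + 1 by rewrite ltr_wpDl.
(* The bound [d] allows absolute continuity to be applied; the other one keeps [d'] times the
   absolute value of [q] below [e], the added 1 avoiding a zero denominator. *)
pose d' := Num.min d (e / (`|q| + 1)).
have d'0 : 0 < d' by rewrite lt_min d0 divr_gt0.
have Nfin : (lebesgue_measure N < +oo)%E by rewrite N0.
have [ O [oO NO Od]] := lebesgue_regularity_outer mN Nfin d'0.
have mO : measurable O by exact: measurable_realfun.open_measurable.
(* Regularity bounds the measure of [O] minus [N]; since [N] is null, the bound passes to [O]. *)
have {}Od : (lebesgue_measure O < d'%:E)%E.
  rewrite (measureDI lebesgue_measure mO mN).
  rewrite [X in (_ + X)%E](_ : _ = 0%E) ?adde0 //.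
  apply/eqP; rewrite -measure_le0 -[X in (_ <= X)%E]N0.
  by rewrite le_measure ?inE //; exact: measurableI.
(* The slope [q + e] may be negative; the second term of [w] compensates for it on the bad
   intervals. *)
pose w s t := K * enorm (y t - y s) + `|q| * (t - s).
have [I [Iin Idis ImO Ig]] : increment_cover O g w (q + e) a b.
  apply: interval_ind ab _ _ => [r s t _ rs st _|t tab].
    exact: increment_cover_trans.
  have [Nt|Nt] := pselect (N t); last first.
    have [dg gq] : derivable g t 1 /\ 'D_1 g t <= q.
      by apply: contrapT => H; apply/Nt/sN => /(_ tab).
    have := derivable_near_increment dg gq e0.
    apply: filterS => s [Hl Hr] _; split=> st; apply: increment_cover_nil.
      exact: Hl.
    exact: Hr.
  have /nbhs_ballP[r /= r0 Or] : nbhs t O.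
    by apply: open_nbhs_nbhs; split => //; exact: NO.
  have slack z : 0 <= z -> 0 <= (q + e) * z + `|q| * z.
    move=> z0; rewrite -mulrDl mulr_ge0 //.
    by have := ler_norm (- q); rewrite normrN => ?; lra.
  near=> s => sab.
  have sr : ball t r s by near: s; exact: nbhsx_ballx.
  have gyst : `|g s - g t| <= K * enorm (y s - y t) by near: s; exact: gy.
  split=> st; apply: increment_cover_segment => //.
  - move=> z /=; rewrite in_itv /= => /andP[sz zt]; apply: Or.
    move: sr; rewrite /ball /= !ger0_norm ?subr_ge0 ?(ltW zt) //; lra.
  - rewrite /w enormB.
    have := slack (t - s); rewrite subr_ge0 => /(_ st).
    have := ler_norm (g t - g s); rewrite distrC; lra.
  - move=> z /=; rewrite in_itv /= => /andP[sz zt]; apply: Or.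
    move: sr; rewrite /ball /= distrC (distrC t).
    rewrite !ger0_norm ?subr_ge0 //; lra.
  - rewrite /w.
    have := slack (s - t); rewrite subr_ge0 => /(_ st).
    have := ler_norm (g s - g t); lra.
have sumE (F : R * R -> R) :
    \sum_(p <- I) F p = \sum_(i < size I) F (nth (0, 0) I i).
  by rewrite (big_nth (0, 0)) big_mkord.
have Id' : \sum_(p <- I) (p.2 - p.1) < d'.
  rewrite -lte_fin; apply: le_lt_trans ImO (le_lt_trans _ Od).
  by rewrite le_measure ?inE //; apply: measurableI.
have Iac : \sum_(p <- I) enorm (y p.2 - y p.1) < e.
  rewrite sumE; apply: Hd => [i|i j ij|].
  - by have /and3P[] := allP Iin _ (mem_nth (0, 0) (ltn_ord i)).
  - have Idis' := pairwiseP (0, 0) Idis.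
    have [lt_ij|] := ltnP i j; first by left; apply: Idis'; rewrite ?inE.
    rewrite leq_eqVlt => /orP[/eqP ji|lt_ji].
      by case/eqP: ij; apply: val_inj.
    by right; apply: Idis'; rewrite ?inE.
  rewrite -(sumE (fun p => p.2 - p.1)); apply: lt_le_trans Id' _.
  by rewrite ge_min lexx.
apply: le_trans Ig _; rewrite /w big_split /= -!mulr_sumr.
have KI := ler_wpM2l K0 (ltW Iac).
have := ler_wpM2l (normr_ge0 q) (ltW Id').
have : `|q| * d' <= e.
  apply: le_trans (ler_wpM2l (normr_ge0 q) (_ : d' <= e / (`|q| + 1))) _.
    by rewrite ge_min lexx orbT.
  rewrite mulrCA ler_piMr ?(ltW e0) // ler_pdivrMr // mul1r; lra.
by move=> *; lra.
Unshelve. all: by end_near.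
Qed.

(** * Chain rule and gradient *)

(** The moving point [z h] follows a trajectory in [is_derive_comp_path] and a coordinate line in
    [grad_eq]. *)
Lemma cvg_difference_quotient (R : realType) (n : nat) (U : 'rV[R]_n -> R)
    (p G D : 'rV[R]_n) (z : R -> 'rV[R]_n) :
  (forall e, 0 < e -> \forall x \near p,
    `|U x - U p - dot G (x - p)| <= e * enorm (x - p)) ->
  h^-1 *: (z h - p) @[h --> 0^'] --> D ->
  h^-1 *: (U (z h) - U p) @[h --> 0^'] --> dot G D.
Proof.
move=> dU zD.
have zp : z h @[h --> 0^'] --> p.
  have h0 : (fun h : R => h) h @[h --> 0^'] --> (0 : R) by exact: nbhs_dnbhs.
  have cv : h *: (h^-1 *: (z h - p)) + p @[h --> 0^'] --> p.
    rewrite -[X in _ --> X]add0r -(scale0r D).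
    exact: cvgD (cvgZ h0 zD) (cvg_cst p).
  apply: cvg_trans cv; apply: near_eq_cvg; near=> h.
  have h_neq0 : h != 0 by near: h; exact: nbhs_dnbhs_neq.
  by rewrite /= scalerA mulfV // scale1r subrK.
apply/cvgrPdist_le => e e0.
(* [B] bounds every quotient within distance 1 of [D]. Then [e1] keeps the remainder of [U], divided
   by [h], below [e / 2], and [e2] does the same for the linear part. *)
pose B := `|D| + 1.
have B0 : 0 < B by rewrite ltr_wpDl.
pose e1 := e / 2 / (n.+1%:R * B).
have e10 : 0 < e1 by rewrite !divr_gt0 ?mulr_gt0.
pose e2 := e / 2 / (n%:R * `|G| + 1).
have nG0 : 0 < n%:R * `|G| + 1 by rewrite ltr_wpDl ?mulr_ge0.
have e20 : 0 < e2 by rewrite !divr_gt0.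
near=> h.
have h_neq0 : h != 0 by near: h; exact: nbhs_dnbhs_neq.
have qD1 : `|D - h^-1 *: (z h - p)| <= 1.
  by near: h; move/cvgrPdist_le : zD; apply.
have qD : `|D - h^-1 *: (z h - p)| <= e2.
  by near: h; move/cvgrPdist_le : zD; apply.
have Uz : `|U (z h) - U p - dot G (z h - p)| <= e1 * enorm (z h - p).
  by near: h; exact: zp (dU _ e10).
set q := h^-1 *: (z h - p) in qD1 qD.
have zq : z h - p = h *: q by rewrite scalerA mulfV // scale1r.
clearbody q.
have -> : dot G D - h^-1 *: (U (z h) - U p) =
    dot G (D - q) - h^-1 * (U (z h) - U p - dot G (z h - p)).
  by rewrite zq dotBr dotZr /GRing.scale /=; field.
apply: le_trans (ler_normB _ _) _; rewrite [leRHS](splitr e) lerD //.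
  apply: le_trans (normr_dot_le _ _) _; rewrite mulrA.
  apply: le_trans (ler_wpM2l _ qD) _; first by rewrite mulr_ge0.
  by rewrite mulrCA ler_piMr ?divr_ge0 ?(ltW e0) // ler_pdivrMr // mul1r lerDl.
rewrite normrM; apply: le_trans (ler_wpM2l _ Uz) _ => //.
apply: le_trans (ler_wpM2l _ (ler_wpM2l (ltW e10) (enorm_le_normr _))) _ => //.
have qB : `|q| <= B.
  rewrite -(subKr D q); apply: le_trans (ler_normB _ _) _.
  by rewrite lerD2l.
rewrite zq normrZ normrV ?unitfE //.
have -> : `|h|^-1 * (e1 * (n.+1%:R * (`|h| * `|q|))) = e1 * (n.+1%:R * `|q|).
  by field; rewrite normr_eq0.
apply: (@le_trans _ _ (e1 * (n.+1%:R * B))).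
  by rewrite !ler_wpM2l // ltW.
by rewrite /e1 divfK // gt_eqF // mulr_gt0.
Unshelve. all: by end_near.
Qed.

(** At interior points of [S] relative neighbourhoods are ordinary ones. This covers every point
    outside a closed target when [S] is the complement of the target's interior. *)
Lemma C1_on_interiorP (R : realType) (n : nat) (S : set 'rV[R]_n)
    (U : 'rV[R]_n -> R) : C1_on S U ->
  exists2 G : 'rV[R]_n -> 'rV[R]_n,
    forall p, nbhs p S -> {for p, continuous G} &
    forall p, nbhs p S -> forall e, 0 < e -> \forall x \near p,
      `|U x - U p - dot (G p) (x - p)| <= e * enorm (x - p).
Proof.
move=> [G Gcont dG]; exists G => p pS.
  by have := Gcont p; rewrite /continuous_at -(nbhs_subspace_interior pS).
move=> e e0; have := dG p (nbhs_singleton pS) e e0.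
rewrite near_withinE => H; near=> x.
apply: (near H x) => //; near: x; exact: pS.
Unshelve. all: by end_near.
Qed.

Lemma dot_delta (R : realType) (n : nat) (u : 'rV[R]_n) (i : 'I_n) :
  dot u (delta_mx 0 i) = u 0 i.
Proof.
rewrite /dot (bigD1 i) //= mxE !eqxx mulr1 big1 ?addr0 // => j ji.
by rewrite mxE (negbTE ji) andbF mulr0.
Qed.

(** Identifies the derivative supplied by [C1_on] with the partial derivatives in which (SC1) is
    stated. *)
Lemma grad_eq (R : realType) (n : nat) (U : 'rV[R]_n -> R) (p G : 'rV[R]_n) :
  (forall e, 0 < e -> \forall x \near p,
    `|U x - U p - dot G (x - p)| <= e * enorm (x - p)) ->
  grad U p = G.
Proof.
move=> dU; apply/rowP => i; rewrite mxE -dot_delta.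
apply/cvg_lim => //; apply: cvg_difference_quotient dU _.
apply: cvg_near_cst; near=> h.
have h_neq0 : h != 0 by near: h; exact: nbhs_dnbhs_neq.
by rewrite /= addrK scalerA mulVf // scale1r.
Unshelve. all: by end_near.
Qed.

Lemma is_derive_comp_path (R : realType) (n : nat) (U : 'rV[R]_n -> R)
    (G D : 'rV[R]_n) (y : R -> 'rV[R]_n) (t : R) :
  (forall e, 0 < e -> \forall x \near y t,
    `|U x - U (y t) - dot G (x - y t)| <= e * enorm (x - y t)) ->
  is_derive t 1 y D -> is_derive t 1 (U \o y) (dot G D).
Proof.
move=> dU [dy yD].
have cvg_q : h^-1 *: (U (y (h *: 1 + t)) - U (y t)) @[h --> 0^'] --> dot G D.
  by apply: cvg_difference_quotient dU _; rewrite -yD; exact: dy.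
by split; [apply/cvg_ex; exists (dot G D)|apply/cvg_lim].
Qed.

(** * Continuity of trajectories, distance to the target, hitting time *)

Lemma absolutely_continuous_uniform (R : realType) (n : nat)
    (y : R -> 'rV[R]_n) (a b : R) :
  absolutely_continuous a b y -> forall e, 0 < e -> exists2 d, 0 < d &
    forall s t, a <= s <= b -> a <= t <= b -> `|s - t| < d ->
      enorm (y s - y t) < e.
Proof.
move=> acy e e0; have [d d0 Hd] := acy e e0; exists d => // s t.
wlog st : s t / s <= t => [H sab tab std|].
  have [st|ts] := leP s t; first exact: H.
  by rewrite enormB; apply: H => //; [exact: ltW|rewrite distrC].
move=> /andP[a_s _] /andP[_ tb] std; rewrite enormB.
have := Hd 1 (fun=> s) (fun=> t); rewrite !big_ord1; apply=> //.
  by move=> i j; rewrite !ord1 eqxx.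
by move: std; rewrite distrC ger0_norm // subr_ge0.
Qed.

Lemma absolutely_continuous_continuous (R : realType) (n : nat)
    (y : R -> 'rV[R]_n) (a b t : R) :
  absolutely_continuous a b y -> a < t < b -> {for t, continuous y}.
Proof.
move=> acy /andP[a_t tb]; apply/cvgrPdist_lt => e e0.
have [d d0 Hd] := absolutely_continuous_uniform acy e0.
near=> s; apply: le_lt_trans (normr_le_enorm _) _; apply: Hd.
- by rewrite !ltW.
- have : s \in `]a, b[ by near: s; apply: near_in_itvoo; rewrite in_itv /= a_t.
  by rewrite in_itv /= => /andP[as_ sb]; rewrite !ltW.
- by near: s; exact: cvgr_dist_lt.
Unshelve. all: by end_near.
Qed.

Lemma edistance_ge0 (R : realType) (n : nat) (T : set 'rV[R]_n)
    (x : 'rV[R]_n) : T !=set0 -> 0 <= edistance T x.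
Proof.
move=> [z Tz]; apply: lb_le_inf; first by exists (enorm (x - z)), z.
by move=> _ [w _ <-]; exact: sqrtr_ge0.
Qed.

Lemma edistance_le (R : realType) (n : nat) (T : set 'rV[R]_n)
    (x z : 'rV[R]_n) : T z -> edistance T x <= enorm (x - z).
Proof.
move=> Tz; have H : has_lbound [set enorm (x - z) | z in T].
  by exists 0 => _ [w _ <-]; exact: sqrtr_ge0.
by apply: (ge_inf H); exists z.
Qed.

Lemma limf_einf_edistance_ge0 (R : realType) (n : nat) (T : set 'rV[R]_n)
    (y : R -> 'rV[R]_n) (F : set_system R) : Filter F -> T !=set0 ->
  (0 <= limf_einf (fun t => (edistance T (y t))%:E) F)%E.
Proof.
move=> FF T0; rewrite limf_einfE.
(* The lower limit is a supremum of infima over members of [F]; the whole line is one of them. *)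
apply: (@le_trans _ _ (ereal_inf [set (edistance T (y t))%:E | t in [set: R]])).
  by apply/ereal_infP => _ [t _ <-]; rewrite lee_fin edistance_ge0.
by apply: ereal_sup_ubound; exists setT => //; exact: filterT.
Qed.

Lemma hitting_time_pinfty (R : realType) (n : nat) (T : set 'rV[R]_n)
    (y : R -> 'rV[R]_n) (t : R) :
  hitting_time T y = +oo%E -> 0 <= t -> ~ T (y t).
Proof.
move=> hit t0 Tyt; suff : (+oo <= t%:E)%E by [].
by rewrite -hit; apply: ereal_inf_lbound; exists t.
Qed.

Lemma hitting_time_ge0 (R : realType) (n : nat) (T : set 'rV[R]_n)
    (y : R -> 'rV[R]_n) : (0 <= hitting_time T y)%E.
Proof. by apply/ereal_infP => _ [t [t0 _] <-]; rewrite lee_fin. Qed.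

(** If [y r] were outside the closed set [T], the path would stay outside for a while after [r], and
    the infimum would exceed [r]. *)
Lemma hitting_time_attained (R : realType) (n : nat) (T : set 'rV[R]_n)
    (y : R -> 'rV[R]_n) (r : R) :
  closed T -> (forall b, 0 <= b -> absolutely_continuous 0 b y) ->
  hitting_time T y = r%:E -> T (y r).
Proof.
move=> Tcl acy hit; apply: contrapT => nTyr.
have r0 : 0 <= r by rewrite -lee_fin -hit hitting_time_ge0.
have /nbhs_ballP[e /= e0 yrT] : nbhs (y r) (~` T).
  by apply: open_nbhs_nbhs; split => //; exact: closed_openC.
have r10 : 0 <= r + 1 by lra.
have [d d0 Hd] := absolutely_continuous_uniform (acy _ r10) e0.
(* The cap 1 keeps the times considered inside [[0, r + 1]], where the modulus [d] is valid. *)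
have d10 : 0 < Num.min d 1 by rewrite lt_min d0 ltr01.
suff : ((r + Num.min d 1)%:E <= r%:E)%E by rewrite lee_fin; lra.
rewrite -hit; apply/ereal_infP => _ [s [s0 Tys] <-]; rewrite lee_fin.
have rs : r <= s by rewrite -lee_fin -hit; apply: ereal_inf_lbound; exists s.
rewrite leNgt; apply/negP => sr; move: Tys; apply: yrT.
have : s < r + d by rewrite (lt_le_trans sr) // lerD2l ge_min lexx.
have : s < r + 1 by rewrite (lt_le_trans sr) // lerD2l ge_min lexx orbT.
move=> s1 sd; rewrite -ball_normE /=.
apply: le_lt_trans (normr_le_enorm _) _; apply: Hd.
- by apply/andP; split => //; lra.
- by apply/andP; split => //; lra.
- by rewrite distrC ger0_norm ?subr_ge0 //; lra.
Qed.

(** Since [y x alpha r] lies in [T], the distance at time [s] is at most the increment of the path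
    between [s] and [r], which vanishes as [s] tends to [r]. *)
Lemma admissible_of_finite_hitting_time (R : realType) (n m : nat)
    (T : set 'rV[R]_n) (A : set 'rV[R]_m)
    (y : 'rV[R]_n -> (R -> 'rV[R]_m) -> R -> 'rV[R]_n)
    (x : 'rV[R]_n) (alpha : R -> 'rV[R]_m) (r : R) :
  closed T -> (forall b, 0 <= b -> absolutely_continuous 0 b (y x alpha)) ->
  y x alpha 0 = x -> ~ T x -> control A alpha ->
  hitting_time T (y x alpha) = r%:E -> admissible T A y x alpha.
Proof.
move=> Tcl acy y0 nTx ctrl hit; split => //; rewrite hit limf_einfE /=.
set z := y x alpha in acy y0 hit *.
have Tzr : T (z r) by exact: hitting_time_attained hit.
have T0 : T !=set0 by exists (z r).
(* Starting outside [T] gives room to approach [r] from the left within [[0, r]]. *)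
have r0 : 0 < r.
  rewrite lt_neqAle -lee_fin -hit hitting_time_ge0 andbT.
  by apply/eqP => r0; apply: nTx; rewrite -y0 r0.
apply/eqP; rewrite eq_le -{2}limf_einfE limf_einf_edistance_ge0 // andbT.
apply: ge_ereal_sup => _ [V rV <-]; apply/lee_addgt0Pr => e e0; rewrite add0e.
have [d d0 Hd] := absolutely_continuous_uniform (acy _ (ltW r0)) e0.
have [s [Vs [s0 sr sd]]] : exists s, V s /\ [/\ 0 < s, s < r & r - s < d].
  apply: (@filter_ex _ r^'-); near=> s; split; first by near: s.
  split; near: s; [exact: nbhs_left_gt|exact: nbhs_left_lt|].
  exact: nbhs_left_ltBl.
apply: ge_ereal_inf; exists (edistance T (z s))%:E; first by exists s.
rewrite lee_fin; apply: le_trans (edistance_le _ Tzr) (ltW (Hd _ _ _ _ _)).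
- by rewrite !ltW.
- by rewrite ltW // lexx.
- by rewrite distrC ger0_norm // subr_ge0 ltW.
Unshelve. all: by end_near.
Qed.

Lemma not_admissible (R : realType) (n m : nat)
    (T : set 'rV[R]_n) (A : set 'rV[R]_m)
    (y : 'rV[R]_n -> (R -> 'rV[R]_m) -> R -> 'rV[R]_n)
    (x : 'rV[R]_n) (alpha : R -> 'rV[R]_m) :
  T !=set0 -> closed T ->
  (forall b, 0 <= b -> absolutely_continuous 0 b (y x alpha)) ->
  y x alpha 0 = x -> ~ T x -> control A alpha ->
  ~ admissible T A y x alpha ->
  hitting_time T (y x alpha) = +oo%E /\
  exists r t0 : R, [/\ 0 < r, 0 < t0 &
    forall t, t0 <= t -> r <= edistance T (y x alpha t)].
Proof.
move=> T0 Tcl acy y0 nTx ctrl nadm.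
have hit : hitting_time T (y x alpha) = +oo%E.
  case hit : (hitting_time T (y x alpha)) => [r|//|].
    by case: nadm; exact: admissible_of_finite_hitting_time hit.
  by have := hitting_time_ge0 T (y x alpha); rewrite hit.
split => //.
move: nadm => /not_andP[//|]; rewrite hit limf_einfE /=.
set S := ereal_sup _ => S0.
have : (0 < S)%E.
  rewrite lt_neqAle eq_sym; apply/andP; split; first exact/eqP.
  by rewrite /S -limf_einfE limf_einf_edistance_ge0.
(* A positive lower limit yields a half-line beyond [M] on which the distance has a positive lower
   bound. *)
move=> /ereal_sup_gt[_ [V [M [_ MV]] <-]] V0.
have dV t : M < t ->
    (ereal_inf [set (edistance T (y x alpha t))%:E | t in V] <=
     (edistance T (y x alpha t))%:E)%E.
  by move=> Mt; apply: ereal_inf_lbound; exists t => //; exact: MV.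
move: V0 dV; case: (ereal_inf _) => [r|_ dV|//].
  (* The time [Num.max M 0 + 1] is both positive and beyond [M]. *)
  rewrite lte_fin => r0 dV; exists r, (Num.max M 0 + 1); split=> //.
    by rewrite ltr_wpDl // le_max lexx orbT.
  move=> t Mt; rewrite -lee_fin; apply: dV.
  by apply: lt_le_trans Mt; rewrite ltr_pwDr // le_max lexx.
(* An infinite infimum is excluded by the finite distance at time [M + 1]. *)
by have := dV (M + 1); rewrite ltrDl ltr01 => /(_ isT).
Qed.

(** * Infinite cost under a positive running cost *)

(** Both integrals are suprema over nonnegative simple functions below the integrand, and one below
    [k] on [E] and 0 elsewhere is also below [g] on [D]. The comparison thus holds for an arbitrary
    nonnegative [g]. *)
Lemma cst_mul_measure_le_integral d (T : measurableType d) (R : realType)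
    (mu : {measure set T -> \bar R}) (D E : set T) (g : T -> \bar R)
    (k : \bar R) :
  measurable E -> E `<=` D -> (0 <= k)%E -> (forall x, D x -> 0 <= g x)%E ->
  (forall x, E x -> k <= g x)%E -> (k * mu E <= \int[mu]_(x in D) g x)%E.
Proof.
move=> mE ED k0 g0 kg; rewrite -integral_cst // !ge0_integralE //.
apply: ge_ereal_sup => _ [h /= hk <-]; apply: ereal_sup_ubound.
exists h => //= x; apply: le_trans (hk x) _; rewrite !patchE.
case: ifPn => [|_]; last by case: ifPn => // /set_mem; exact: g0.
by move=> /set_mem Ex; rewrite mem_set ?kg //; exact: ED.
Qed.

Lemma cost_pinfty (R : realType) (n m : nat)
    (l : 'rV[R]_n -> 'rV[R]_m -> R) (y : R -> 'rV[R]_n) (alpha : R -> 'rV[R]_m)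
    (k t0 : R) :
  0 < k -> 0 <= t0 -> (forall s, 0 <= s -> 0 <= l (y s) (alpha s)) ->
  (forall s, t0 <= s -> k <= l (y s) (alpha s)) ->
  cost l y alpha +oo = +oo%E.
Proof.
move=> k0 t00 l0 kl; apply/eqP; rewrite -leye_eq.
pose E : set R := `[t0, +oo[%classic.
have mE : ((wlength (@idfun R))^*)%mu.-cara.-measurable E.
  by apply: sub_caratheodory; exact: measurable_itv.
have muE : @completed_lebesgue_measure R E = +oo%E.
  by have := lebesgue_measure_itv `[t0, +oo[; rewrite /= ltry.
have kmuE : (k%:E * @completed_lebesgue_measure R E = +oo)%E.
  by rewrite muE gt0_muley // lte_fin.
rewrite -[X in (X <= _)%E]kmuE; apply: cst_mul_measure_le_integral => //.
- move=> s; rewrite /E /= in_itv /= andbT => t0s; split; last exact: ltry.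
  exact: le_trans t0s.
- by rewrite lee_fin ltW.
- by move=> s /= [s0 _]; rewrite lee_fin l0.
- by move=> s; rewrite /E /= in_itv /= andbT lee_fin => /kl.
Qed.

(** * Decrease of [U] along trajectories *)

Lemma C1_increment_along_solution (R : realType) (n m : nat)
    (S : set 'rV[R]_n) (U : 'rV[R]_n -> R)
    (f : 'rV[R]_n -> 'rV[R]_m -> 'rV[R]_n) (x : 'rV[R]_n)
    (alpha : R -> 'rV[R]_m) (y : R -> 'rV[R]_n) (a b q : R) :
  C1_on S U -> solution f x alpha y -> 0 < a -> a <= b ->
  (forall t, a <= t <= b -> nbhs (y t) S) ->
  (forall t, a <= t <= b -> dot (grad U (y t)) (f (y t) (alpha t)) <= q) ->
  U (y b) - U (y a) <= q * (b - a).
Proof.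
move=> /C1_on_interiorP[G Gcont dU] [_ acy dy] a0 ab yS fq.
have t_gt0 t : a <= t <= b -> 0 < t by case/andP => + _; exact: lt_le_trans.
have b0 : 0 <= b by rewrite ltW // (lt_le_trans a0).
(* Continuity is available at interior times only, so the interval is extended beyond [b] to include
   that endpoint. *)
have b10 : 0 <= b + 1 by rewrite addr_ge0.
have ycont t : a <= t <= b -> {for t, continuous y}.
  move=> tab; apply: (absolutely_continuous_continuous (acy _ b10)).
  by rewrite t_gt0 //=; case/andP: tab => _ tb; rewrite ltr_pwDr.
have [c _ Gc] : exists2 c, c \in `[a, b] &
    forall t, t \in `[a, b] -> `|G (y t)| <= `|G (y c)|.
  apply: (@EVT_max _ (fun t => `|G (y t)|)) => //.
  apply: continuous_in_subspaceT => t /set_mem; rewrite /= in_itv /= => tab.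
  apply: continuous_comp (@norm_continuous _ _ _).
  by apply: continuous_comp; [exact: ycont|exact/Gcont/yS].
have acab : absolutely_continuous a b y.
  move=> e e0; have [d d0 Hd] := acy b b0 e e0; exists d => // k u v uv.
  apply: Hd => i; have [au ? ?] := uv i; split=> //.
  exact: le_trans (ltW a0) au.
(* The constant adds the bound of the linear part, with [G] at its largest on the arc, and 1 for the
   remainder of [U] taken with tolerance 1. *)
have K0 : 0 <= n%:R * `|G (y c)| + 1 by rewrite addr_ge0 // mulr_ge0.
apply: (absolutely_continuous_increment_le (g := U \o y) ab K0 acab).
  move=> t tab; have nU : \forall s \near t, `|U (y s) - U (y t) -
      dot (G (y t)) (y s - y t)| <= 1 * enorm (y s - y t).
    exact: ycont t tab _ (dU _ (yS t tab) 1 ltr01).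
  apply: filterS nU => s; rewrite mul1r mulrDl mul1r => Us.
  rewrite -(subrK (dot (G (y t)) (y s - y t)) (U (y s) - U (y t))).
  apply: le_trans (ler_normD _ _) _; rewrite addrC lerD //.
  apply: le_trans (normr_dot_le _ _) _.
  rewrite mulrA ler_pM ?mulr_ge0 ?normr_le_enorm // ler_wpM2l //.
  by apply: Gc; rewrite in_itv.
apply: negligibleS dy; apply: subsetC => t /= dyt tab.
have [dUy Uyq] := is_derive_comp_path (dU _ (yS t tab)) (dyt (t_gt0 t tab)).
by split => //; rewrite Uyq -(grad_eq (dU _ (yS t tab))); exact: fq.
Qed.

Lemma SC1_not_away_from_target (R : realType) (n m : nat)
    (T : set 'rV[R]_n) (A : set 'rV[R]_m)
    (f : 'rV[R]_n -> 'rV[R]_m -> 'rV[R]_n) (x : 'rV[R]_n)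
    (alpha : R -> 'rV[R]_m) (y : R -> 'rV[R]_n) (r t0 : R) :
  closed T -> SC1 T A f -> control A alpha -> solution f x alpha y ->
  0 < r -> 0 < t0 -> (forall t, t0 <= t -> ~ T (y t)) ->
  ~ (forall t, t0 <= t -> r <= edistance T (y t)).
Proof.
move=> Tcl [U [U0 UC1 _ _ [mu [_ mu_incr mu_gt0] Umu]]] [ctrl _] sol.
move=> r0 t00 yT rd.
have subTC : ~` T `<=` ~` T° by apply: subsetC; exact: interior_subset.
have mur0 := mu_gt0 r r0.
have Ut0 : 0 <= U (y t0) by apply/U0/subTC/yT.
(* Decreasing at rate [mu r], [U] would reach 0 by time [t0 + U (y t0) / mu r]; the extra unit of
   time makes it negative. *)
pose b := t0 + U (y t0) / mu r + 1.
have t0b : t0 <= b by rewrite /b -addrA lerDl addr_ge0 // divr_ge0 // ltW.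
have Ub : 0 <= U (y b) by apply/U0/subTC/yT.
suff : U (y b) - U (y t0) <= - mu r * (b - t0).
  have -> : - mu r * (b - t0) = - U (y t0) - mu r.
    by rewrite /b; field; rewrite gt_eqF.
  lra.
apply: (C1_increment_along_solution UC1 sol t00 t0b) => t /andP[t0t _].
  apply: filterS subTC _; apply: open_nbhs_nbhs; split; last exact: yT.
  exact: closed_openC.
rewrite -lee_fin; apply: le_trans (_ : _ <= (- mu (edistance T (y t)))%:E)%E _.
  apply: le_trans (Umu _ (yT t t0t)); apply: ereal_sup_ubound.
  by exists (alpha t) => //; apply: ctrl; rewrite (le_trans (ltW t00)).
by rewrite lee_fin lerN2 mu_incr // rd.
Qed.

Theorem proposition2p3 (R : realType) (n m : nat)
  (A : set 'rV[R]_m) (T : set 'rV[R]_n)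
  (f : 'rV[R]_n -> 'rV[R]_m -> 'rV[R]_n) (l : 'rV[R]_n -> 'rV[R]_m -> R)
  (y : 'rV[R]_n -> (R -> 'rV[R]_m) -> R -> 'rV[R]_n)
  (A_compact : compact A)
  (T_nonempty : T !=set0) (T_closed : closed T)
  (T_boundary : compact (closure T `\` interior T))
  (f_continuous :
    {within [set p : 'rV[R]_n * 'rV[R]_m | A p.2],
      continuous (fun p : 'rV[R]_n * 'rV[R]_m => f p.1 p.2)})
  (l_continuous :
    {within [set p : 'rV[R]_n * 'rV[R]_m | A p.2],
      continuous (fun p : 'rV[R]_n * 'rV[R]_m => l p.1 p.2)})
  (l_ge0 : forall x a, A a -> 0 <= l x a)
  (f_growth : exists2 M : R, 0 < M &
    forall x a, A a -> enorm (f x a) <= M * (1 + enorm x))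
  (fl_lipschitz : forall r : R, 0 < r -> exists2 L : R, 0 < L &
    forall x1 x2 a, enorm x1 <= r -> enorm x2 <= r -> A a ->
      enorm (f x1 a - f x2 a) <= L * enorm (x1 - x2) /\
      `|l x1 a - l x2 a| <= L * enorm (x1 - x2))
  (y_solution : forall x alpha, control A alpha ->
    solution f x alpha (y x alpha)) :
  SC1 T A f \/ SC2 T A l ->
  forall x, ~ T x -> value T A l y x = value_m T A l y x.
Proof.
move=> SC x nTx; apply/eqP; rewrite eq_le; apply/andP; split; last first.
  by apply: ereal_inf_le_tmp => _ [alpha [ctrl _] <-]; exists alpha.
apply/ereal_infP => _ [alpha ctrl <-].
(* An admissible control competes in both infima; a non-admissible one is impossible under (SC1) and
   costs [+oo] under (SC2). *)
have [adm|nadm] := pselect (admissible T A y x alpha).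
  by apply: ereal_inf_lbound; exists alpha.
have sol := y_solution x alpha ctrl; have [y0 acy _] := sol.
have [hit [r [t0 [r0 t00 rd]]]] :=
  not_admissible T_nonempty T_closed acy y0 nTx ctrl nadm.
have yT t : 0 <= t -> ~ T (y x alpha t) by exact: hitting_time_pinfty hit.
have t_ge0 t : t0 <= t -> 0 <= t by exact: le_trans (ltW t00).
case: SC => [sc1|[c2 [_ c2_incr c2_gt0] c2l]].
  have yT' t : t0 <= t -> ~ T (y x alpha t) by move=> /t_ge0; exact: yT.
  by have := SC1_not_away_from_target T_closed sc1 ctrl sol r0 t00 yT' rd.
rewrite hit (cost_pinfty (c2_gt0 _ r0) (ltW t00)) ?leey // => s.
  by move=> s0; apply/l_ge0/ctrl.1.
move=> t0s; apply: le_trans (c2_incr _ _ r0 (rd _ t0s)) (c2l _ _ _ _).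
  by apply: yT; exact: t_ge0.
by apply: ctrl.1; exact: t_ge0.
Qed.
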